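(* Let $n\ge2$, let $A$ be an $n\times n$ integer dilation matrix with $|\det(A)|=d$, and let $\{V_j\}_{j=0}^\infty$ be a projective multiresolution analysis for $\Xi$ corresponding to dilation by $A$. Let $W_i=V_{i+1}\ominus V_i$ for $i\ge0$. If $W_0$ is a free $C(\mathbb T^n)$-module of rank $r$, then for every $i\in\mathbb N$ the module $W_i$ is a free $C(\mathbb T^n)$-module of rank $r d^i$.
   Context: Write $e(r)=e^{2\pi i r}$. Functions in $C(\mathbb T^n)$ are identified with continuous $\mathbb Z^n$-periodic functions on $\mathbb R^n$. An integer dilation matrix is an integer matrix all of whose eigenvalues have modulus strictly greater than $1$. $\Xi$ is the right Hilbert $C(\mathbb T^n)$-module obtained by completing $C_c(\mathbb R^n)$ with respect to the norm $\|\xi\|=\|\langle\xi,\xi\rangle_{C(\mathbb T^n)}\|_\infty^{1/2}$ determined by $\langle \xi,\eta\rangle_{C(\mathbb T^n)}(t)=\sum_{p\in\mathbb Z^n}(\overline{\xi}\eta)(t-p)$, with $C(\mathbb T^n)$ acting by pointwise multiplication; its elements are continuous functions on $\mathbb R^n$ and $\Xi\subseteq L^2(\mathbb R^n)$. $D=\mathcal F D_A\mathcal F^{*}$, where $D_A(\zeta)(x)=|\det A|^{1/2}\zeta(Ax)$ on $L^2(\mathbb R^n)$ and $\mathcal F(f)(x)=\int_{\mathbb R^n}f(t)e(-t\cdot x)\,dt$; explicitly $(D\xi)(x)=|\det A|^{-1/2}\xi((A^t)^{-1}x)$. A sequence $\{V_j\}_{j\in\mathbb Z}$ of subspaces of $\Xi$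 is a projective multiresolution analysis for dilation by $A$ if: (i) $V_0$ is a finitely generated projective $C(\mathbb T^n)$-submodule of $\Xi$; (ii) $V_j=D^j(V_0)$ for all $j$; (iii) $V_j\subset V_{j+1}$ for all $j\in\mathbb Z$; (iv) $\bigcup_{j\ge0}V_j$ is dense in $\Xi$ in the Hilbert $C(\mathbb T^n)$-module norm; (v) $\bigcap_{j\in\mathbb Z}V_j=\{0\}$. (Here only the terms with $j\ge0$ are displayed.) $V_{i+1}\ominus V_i$ is the orthogonal complement of $V_i$ in $V_{i+1}$ with respect to the $C(\mathbb T^n)$-valued inner product. *)

(* Defs.v *)
From HB Require Import structures.
From mathcomp Require Import all_boot all_order all_algebra.
From mathcomp Require Import complex.
From mathcomp Require Import all_classical all_reals all_analysis.
From mathcomp Require Import summability.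

Set Implicit Arguments.
Unset Strict Implicit.
Unset Printing Implicit Defensive.

Import Order.TTheory GRing.Theory Num.Theory.
Import numFieldNormedType.Exports.

Local Open Scope classical_set_scope.
Local Open Scope ring_scope.

(* R[i] at a type from which its topology and norm are inferred. *)
Definition cplx (R : realType) : numClosedFieldType := R[i].

Definition lattice (R : realType) (n : nat) (p : 'cV[int]_n) : 'cV[R]_n :=
  map_mx intr p.

Section Torus.
Variables (R : realType) (n : nat).
Local Notation C := (cplx R).

Definition torus_fun : {pred 'cV[R]_n -> C} := [pred f | `[<
  continuous f /\ forall t (p : 'cV[int]_n), f (t - lattice R p) = f t >]].

Fact torus_fun_subring : subring_closed torus_fun.
Proof.
split.
- apply/asboolP; split => [|t p]; last by [].
  by move=> x; exact: cst_continuous.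
- move=> f g /asboolP[cf pf] /asboolP[cg pg]; apply/asboolP; split.
  + by move=> x; apply: continuousB; [exact: cf | exact: cg].
  + by move=> t p; rewrite !fctE pf pg.
- move=> f g /asboolP[cf pf] /asboolP[cg pg]; apply/asboolP; split.
  + by move=> x; apply: continuousM; [exact: cf | exact: cg].
  + by move=> t p; rewrite !fctE pf pg.
Qed.

HB.instance Definition _ :=
  GRing.isSubringClosed.Build ('cV[R]_n -> C) torus_fun torus_fun_subring.

(* C(T^n), as the ring of continuous Z^n-periodic functions on R^n. *)
Record CT : Type := MkCT { CTval :> 'cV[R]_n -> C; _ : CTval \in torus_fun }.
HB.instance Definition _ := [isSub for CTval].
HB.instance Definition _ := [Choice of CT by <:].
HB.instance Definition _ := [SubChoice_isSubComNzRing of CT by <:].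

(* All functions R^n -> C, with C(T^n) acting by pointwise multiplication. *)
Definition funRn : Type := 'cV[R]_n -> C.
HB.instance Definition _ := GRing.Zmodule.copy funRn ('cV[R]_n -> C).

Definition CTscale (f : CT) (xi : funRn) : funRn := fun x => f x * xi x.

Fact CTscaleA f g xi : CTscale f (CTscale g xi) = CTscale (f * g) xi.
Proof. by apply/funext => x; rewrite /CTscale mulrA. Qed.
Fact CTscale1 : left_id 1 CTscale.
Proof. by move=> xi; apply/funext => x; rewrite /CTscale mul1r. Qed.
Fact CTscaleDr : right_distributive CTscale +%R.
Proof. by move=> f u v; apply/funext => x; rewrite /CTscale mulrDr. Qed.
Fact CTscaleDl u : {morph CTscale^~ u : f g / f + g}.
Proof. by move=> f g; apply/funext => x; rewrite /CTscale mulrDl. Qed.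
HB.instance Definition _ := GRing.Zmodule_isLmodule.Build CT funRn
  CTscaleA CTscale1 CTscaleDr CTscaleDl.

Definition inner (xi eta : funRn) : funRn := fun t =>
  sum (fun p : 'cV[int]_n => (xi (t - lattice R p))^* * eta (t - lattice R p)).

(* The supremum is meaningful as soon as inner xi xi is a bounded function,
   which is the case on Cc and on Xi. *)
Definition Xinorm (xi : funRn) : R :=
  Num.sqrt (sup (range (fun t => complex.Re `|inner xi xi t|))).

Definition Cc : set funRn := [set xi |
  continuous (xi : 'cV[R]_n -> C) /\ compact (closure [set x | xi x != 0])].

(* The completion of Cc, each class of Cauchy sequences being identified with
   its pointwise limit: the norm dominates the sup norm, and by Fatou a Cauchy
   sequence converging pointwise to 0 converges to 0 in norm.  On Cc the sums
   defining inner are finite. *)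
Definition Xi : set funRn := [set xi | exists phi : nat -> funRn,
  [/\ forall k, Cc (phi k),
      forall e : R, 0 < e -> exists N, forall k l, (N <= k)%N -> (N <= l)%N ->
        Xinorm (phi k - phi l) < e
    & forall x, phi k x @[k --> \oo] --> (xi x : C)]].

End Torus.

Section Modules.
Variables (K : comNzRingType) (M : lmodType K).

Definition linear_on (N : lmodType K) (P : set N) (f : N -> M) :=
  forall (a : K) u v, P u -> P v -> f (a *: u + v) = a *: f u + f v.

(* W is a submodule isomorphic to K^r. *)
Definition free_of_rank (W : set M) (r : nat) :=
  exists f : {linear 'rV[K]_r -> M}, set_bij setT W f.

(* V is isomorphic to a direct summand P of some K^m. *)
Definition fg_projective (V : set M) :=
  exists m (P Q : set 'rV[K]_m) (f : 'rV[K]_m -> M),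
  [/\ submod_closed [in P] /\ submod_closed [in Q],
      P `&` Q = [set 0],
      [set p + q | p in P & q in Q] = setT,
      linear_on P f
    & set_bij P V f].

End Modules.

Definition dilation_matrix (R : realType) (n : nat) (A : 'M[int]_n) :=
  forall z : R[i], eigenvalue (map_mx intr A : 'M[R[i]]_n) z -> 1 < `|z|.

Section Dilation.
Variables (R : realType) (n : nat) (A : 'M[int]_n).
Local Notation C := (cplx R).
Local Notation funRn := (funRn R n).

Definition realAt : 'M[R]_n := (map_mx intr A)^T.

Definition sqrtdet : R := Num.sqrt `|(\det A)%:~R|.

(* The conjugate by the Fourier transform of zeta |-> |det A|^(1/2) zeta(A x),
   defined pointwise so as to make sense outside L^1 and L^2. *)
Definition Dil (xi : funRn) : funRn :=
  fun x => (sqrtdet^-1)%:C%C * xi (invmx realAt *m x).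

Definition Dil_inv (xi : funRn) : funRn :=
  fun x => sqrtdet%:C%C * xi (realAt *m x).

Fact realAt_unit : \det A != 0 -> realAt \in unitmx.
Proof. by move=> A0; rewrite unitmxE det_tr det_map_mx unitfE intr_eq0. Qed.

Fact sqrtdet_neq0 : \det A != 0 -> sqrtdet != 0.
Proof. by move=> A0; rewrite sqrtr_eq0 -ltNge normr_gt0 intr_eq0. Qed.

Fact DilK : \det A != 0 -> cancel Dil Dil_inv.
Proof.
move=> A0 xi; apply/funext => x; rewrite /Dil_inv /Dil mulKmx ?realAt_unit//.
by rewrite mulrA -rmorphM/= mulfV ?sqrtdet_neq0// rmorph1 mul1r.
Qed.

Fact Dil_invK : \det A != 0 -> cancel Dil_inv Dil.
Proof.
move=> A0 xi; apply/funext => x; rewrite /Dil_inv /Dil mulKVmx ?realAt_unit//.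
by rewrite mulrA -rmorphM/= mulVf ?sqrtdet_neq0// rmorph1 mul1r.
Qed.

Definition Dpow (j : int) (xi : funRn) : funRn :=
  match j with
  | Posz k => iter k Dil xi
  | Negz k => iter k.+1 Dil_inv xi
  end.

Record projective_MRA (V : int -> set funRn) : Prop := {
  PMRA_Xi : forall j, V j `<=` @Xi R n;
  PMRA_subspace : forall j, V j 0 /\ forall (c : C) u v, V j u -> V j v ->
    V j (fun x => c * u x + v x);
  PMRA_submod : submod_closed [in V 0];
  PMRA_proj : fg_projective (V 0);
  PMRA_dil : forall j, V j = Dpow j @` V 0;
  PMRA_incr : forall j, V j `<=` V (j + 1);
  PMRA_dense : forall xi, Xi xi -> forall e : R, 0 < e ->
    exists (j : nat) (eta : funRn), V j eta /\ Xinorm (xi - eta) < e;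
  PMRA_cap : \bigcap_j V j = [set 0]
}.

(* V (-) U, relative to the C(T^n)-valued inner product. *)
Definition ominus (V U : set funRn) : set funRn :=
  [set xi | V xi /\ forall eta, U eta -> inner eta xi = 0].

End Dilation.

(* Main.v *)
Require Import Defs.
From HB Require Import structures.
From mathcomp Require Import all_boot all_order all_algebra.
From mathcomp Require Import all_classical all_reals all_analysis.
From mathcomp Require Import complex summability finmap.
From mathcomp Require Import ring lra zify.

(* Put M = (A^T)^i, so that D^i xi (x) = c xi (M^-1 x) with c = |det A|^(-i/2).
   Summing over the classes of Z^n modulo M Z^n shows that <D^i eta, D^i xi>(t) is
   |c|^2 times the sum of <eta, xi>(M^-1 (t - q)) over q in Z^n / M Z^n; hence
   W_i = D^i W_0.  Through D^i,
   multiplication by a(x) in C(T^n) becomes multiplication by a(M x) on W_0, so W_i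
   is W_0 = C(T^n)^r with scalars restricted along a |-> a(M x).  It remains to see
   that C(T^n) is free of rank |det M| = d^i over the image of this map: a basis is
   given by the characters e(k . x), for k in Z^n / M^T Z^n. *)

Set Implicit Arguments.
Unset Strict Implicit.
Unset Printing Implicit Defensive.
Import Order.TTheory GRing.Theory Num.Theory.
Import numFieldNormedType.Exports.
Local Open Scope classical_set_scope.
Local Open Scope ring_scope.

(** * The topology of C *)

Section Modulus.
Variable R : realType.
Local Notation C := (cplx R).
Implicit Types z w : C.

(** The norm of [C] takes its values in [C] itself; suprema and order estimates need a real-valued
    modulus. *)
Definition modulus z : R := complex.Re `|z|.

Lemma modulusE z : (modulus z)%:C%C = `|z|.
Proof. by rewrite /modulus; case: z => a b; rewrite normc_def. Qed.

Lemma modulus_ge0 z : 0 <= modulus z.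
Proof. by have := normr_ge0 z; rewrite -modulusE ler0c. Qed.

Lemma modulusD z w : modulus (z + w) <= modulus z + modulus w.
Proof. by have := ler_normD z w; rewrite -!modulusE -rmorphD lecR. Qed.

Lemma modulusM z w : modulus (z * w) = modulus z * modulus w.
Proof. by apply: complexI; rewrite rmorphM !modulusE normrM. Qed.

Lemma modulus_conj z : modulus z^* = modulus z.
Proof. by rewrite /modulus norm_conjC. Qed.

Lemma conjM_modulus z : z^* * z = (modulus z ^+ 2)%:C%C.
Proof. by rewrite rmorphXn /= modulusE mulrC normCK. Qed.

Lemma Re_le_modulus z : `|complex.Re z| <= modulus z.
Proof. by have := normc_ge_Re z; rewrite -modulusE lecR. Qed.

Lemma Im_le_modulus z : `|complex.Im z| <= modulus z.
Proof.
(* The real part of z i is - Im z, and i has modulus 1. *)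
have := Re_le_modulus (z * 'i%C); rewrite ReiNIm normrN modulusM.
by rewrite {2}/modulus normc_def /= expr0n expr1n add0r sqrtr1 mulr1.
Qed.

Lemma real_complex_continuous : continuous (fun x : R => x%:C%C : C).
Proof.
(* A radius that is positive in [C] has zero imaginary part. *)
move=> x; apply/cvgrPdist_lt => -[e e'] /=; rewrite ltcE /= => /andP[/eqP -> e0].
near=> y; rewrite -rmorphB /= normc_def /= expr0n addr0 sqrtr_sqr ltcR.
by near: y; exact: (@cvgr_dist_lt _ _ _ _ _ id).
Unshelve. all: by end_near. Qed.

Lemma Re_continuous : continuous (fun z : C => complex.Re z).
Proof.
move=> z; apply/(@cvgrPdist_lt _ _ _ _ (nbhs_filter z)) => e e0; near=> w.
rewrite -raddfB; apply: (le_lt_trans (Re_le_modulus (z - w))).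
by rewrite -ltcR modulusE; near: w; apply: (nbhsx_ballx z e%:C%C); rewrite ltcR.
Unshelve. all: by end_near. Qed.

Lemma modulus_continuous : continuous modulus.
Proof.
move=> z; apply: (@continuous_comp _ _ _ (fun w : C => `|w|) _ z).
  exact: norm_continuous.
exact: Re_continuous.
Qed.

Lemma cvg_complex (T : Type) (F : set_system T) (FF : Filter F) (u : T -> C)
    (a b : R) :
  complex.Re (u x) @[x --> F] --> a -> complex.Im (u x) @[x --> F] --> b ->
  u @ F --> ((a +i* b)%C : C).
Proof.
move=> ua ub.
have -> : u = (fun x => (complex.Re (u x))%:C%C + 'i%C * (complex.Im (u x))%:C%C).
  by apply/funext => x; rewrite -complexE.
rewrite [(a +i* b)%C]complexE /=.
apply: (@cvgD _ C).
  exact: (continuous_cvg _ (@real_complex_continuous _) ua).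
apply: (@cvgM C _ _ FF (fun=> 'i%C : C)); first exact: cvg_cst.
exact: (continuous_cvg _ (@real_complex_continuous _) ub).
Qed.

End Modulus.

(** * Unordered sums *)

#[local] Existing Instance totally_filter.

Section HasSum.
Variable I : choiceType.

Lemma partial_sumE (V : zmodType) (x : I -> V) (J : {fset I}) :
  partial_sum x J = \sum_(i <- J) x i.
Proof. by rewrite /partial_sum [RHS]big_seq_fsetE. Qed.

(** [sum] is a limit over finite subsets, with a default value when there is none; this predicate
    keeps the convergence itself. *)
Definition has_sum (K : numDomainType) (V : normedModType K) (x : I -> V) (s : V)
  := partial_sum x @ totally --> s.

Lemma has_sum_sum (K : numFieldType) (V : normedModType K) (x : I -> V) (s : V) :
  has_sum x s -> sum x = s.
Proof. by move=> xs; exact: (cvg_lim (@norm_hausdorff K V)) xs. Qed.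

Lemma le_partial_sum (R : numDomainType) (x : I -> R) (J J' : {fset I}) :
  (forall i, 0 <= x i) -> (J `<=` J')%fset -> partial_sum x J <= partial_sum x J'.
Proof.
move=> x0 JJ'; rewrite !partial_sumE.
rewrite [leRHS](big_fsetID _ (fun i => i \in J)) /=.
rewrite (_ : [fset i in J' | i \in J]%fset = J); last first.
  by apply/fsetP => i; rewrite !inE /= andb_idl// => /(fsubsetP JJ').
by rewrite lerDl sumr_ge0.
Qed.

Variable R : realType.

(** The partial sums increase with the finite set, so they converge to their supremum, which is the
    witness. *)
Lemma has_sum_ge0 (x : I -> R) (M : R) : (forall i, 0 <= x i) ->
  (forall J, partial_sum x J <= M) ->
  exists s, has_sum x s /\ forall J, partial_sum x J <= s <= M.
Proof.
move=> x0 xM; pose S := range (partial_sum x).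
have supS : has_sup S.
  split; first by exists (partial_sum x fset0), fset0.
  by exists M => _ [J _ <-].
have xs J : partial_sum x J <= sup S by apply: ub_le_sup; [case: supS|exists J].
exists (sup S); split; last first.
  move=> J; rewrite xs /=; apply: ge_sup; first by case: supS.
  by move=> _ [J' _ <-].
apply/cvgrPdist_lt => e e0.
have [_ [J _ <-] Je] := sup_adherent e0 supS.
exists J => // J' /= JJ'.
rewrite ger0_norm ?subr_ge0 ?xs // ltrBlDr -ltrBlDl.
by apply: (lt_le_trans Je); exact: le_partial_sum.
Qed.

(** Write x = (x + y) - y: both families are nonnegative, with partial sums bounded by 2M and M. *)
Lemma cvg_abs_summable (x y : I -> R) (M : R) : (forall i, `|x i| <= y i) ->
  (forall J, partial_sum y J <= M) -> exists s, has_sum x s.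
Proof.
move=> xy yM.
have y0 i : 0 <= y i by apply: le_trans (xy i).
have [s [ys _]] := has_sum_ge0 y0 yM.
have xy0 i : 0 <= x i + y i.
  by have := xy i; rewrite ler_norml -lerBlDr sub0r => /andP[].
have xyM J : partial_sum (fun i => x i + y i) J <= M + M.
  rewrite !partial_sumE (le_trans (y := \sum_(i <- J) (y i + y i)))//.
    by apply: ler_sum => i _; rewrite lerD2r (le_trans (ler_norm _)).
  by rewrite big_split /= lerD // -partial_sumE.
have [s' [xys _]] := has_sum_ge0 xy0 xyM.
exists (s' - s); rewrite /has_sum.
have -> : partial_sum x =
    partial_sum (fun i => x i + y i) - partial_sum y.
  by apply/funext => J; rewrite !fctE !partial_sumE big_split /= addrK.
exact: cvgB.
Qed.

Lemma cvg_modulus_summable (x : I -> cplx R) (y : I -> R) (M : R) :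
  (forall i, modulus (x i) <= y i) -> (forall J, partial_sum y J <= M) ->
  exists s, has_sum x s.
Proof.
move=> xy yM.
have [a xa] := @cvg_abs_summable (fun i => complex.Re (x i)) y M
  (fun i => le_trans (Re_le_modulus _) (xy i)) yM.
have [b xb] := @cvg_abs_summable (fun i => complex.Im (x i)) y M
  (fun i => le_trans (Im_le_modulus _) (xy i)) yM.
exists (a +i* b)%C; apply: cvg_complex.
- apply: cvg_trans xa; apply: near_eq_cvg; near=> J.
  by rewrite !partial_sumE raddf_sum.
- apply: cvg_trans xb; apply: near_eq_cvg; near=> J.
  by rewrite !partial_sumE raddf_sum.
Unshelve. all: by end_near. Qed.

End HasSum.

(** The fibre of [red] over q is parametrised bijectively by [h q]. A finite partial sum over [J]
    splits into N partial sums over [I], one per fibre, and each of these converges. *)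
Lemma has_sum_fibers (K : numFieldType) (I J : choiceType) (N : nat)
    (red : J -> 'I_N) (quo : J -> I) (h : 'I_N -> I -> J) (a : J -> K)
    (s : 'I_N -> K) :
  (forall q, injective (h q)) -> (forall q i, red (h q i) = q) ->
  (forall j, h (red j) (quo j) = j) ->
  (forall q, has_sum (fun i => a (h q i)) (s q)) ->
  has_sum a (\sum_q s q).
Proof.
move=> hinj hred hK has; rewrite /has_sum.
pose fib q (S : {fset J}) := [fset quo j | j in [fset j in S | red j == q]]%fset.
have -> : partial_sum a =
    fun S => \sum_q partial_sum (fun i => a (h q i)) (fib q S).
  apply/funext => S; rewrite partial_sumE (partition_big red xpredT) //=.
  apply: eq_bigr => q _; rewrite partial_sumE big_imfset /=; last first.
    move=> j j'; rewrite !inE /= => /andP[_ /eqP jq] /andP[_ /eqP j'q] e.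
    by rewrite -(hK j) -(hK j') jq j'q e.
  rewrite [RHS]big_fset /=; apply: eq_big => //= j /eqP <-.
  by rewrite hK.
apply: (cvg_big (@add_continuous K)) => q _.
apply: (cvg_comp _ _ _ (has q)) => A [B _ BA].
(* As soon as S contains the image of B under [h q], its trace [fib q S] contains B. *)
exists [fset h q i | i in B]%fset => // S /= BS; apply: BA => /=.
apply/fsubsetP => i iB; apply/imfsetP; exists (h q i) => /=.
  by rewrite !inE /= hred eqxx andbT; apply: (fsubsetP BS); exact: in_imfset.
by apply: (hinj q); rewrite -{1}[LHS]hK hred.
Qed.

(** * Square summability *)

Section SquareSummability.
Variables (R : realType) (n : nat).
Local Notation C := (cplx R).
Local Notation lattice := (lattice R).
Implicit Types xi eta psi : funRn R n.

Definition sqterm xi (t : 'cV[R]_n) (p : 'cV[int]_n) : R :=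
  modulus (xi (t - lattice p) : C) ^+ 2.

Lemma sqterm_ge0 xi t p : 0 <= sqterm xi t p.
Proof. exact: sqr_ge0. Qed.

Lemma partial_sum_le_card (I : choiceType) (g : I -> R) (b : R) (T J : {fset I}) :
  (forall p, 0 <= g p <= b) -> (forall p, p \notin T -> g p = 0) ->
  partial_sum g J <= b *+ #|` T|.
Proof.
move=> gb gT; have g0 p : 0 <= g p by have /andP[] := gb p.
apply: (le_trans (le_partial_sum g0 (fsubsetUl J T))).
rewrite partial_sumE -(big_fset_incl _ (fsubsetUr J T)) //; last first.
  by move=> p _ /gT.
rewrite card_fset_sum1 -sumrMnr.
by apply: ler_sum => p _; have /andP[] := gb p.
Qed.

Lemma Cc_modulus_bounded psi : Cc psi ->
  exists b, forall x, modulus (psi x : C) <= b.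
Proof.
move=> [cpsi K].
have : compact ((fun x => modulus (psi x : C)) @` closure [set x | psi x != 0]).
  apply: continuous_compact => //; apply: continuous_subspaceT => x.
  by apply: (continuous_comp (cpsi x)); exact: modulus_continuous.
move=> /compact_bounded [b [_ /(_ (`|b| + 1))]] hb.
exists (`|b| + 1) => x; have [->|px] := eqVneq (psi x) 0.
  by rewrite /modulus normr0 /= addr_ge0.
apply: le_trans (ler_norm _) _; apply: hb.
  by rewrite (le_lt_trans (ler_norm b))// ltrDl.
by exists x => //; exact: subset_closure.
Qed.

Lemma Cc_support_bounded psi : Cc psi ->
  exists L : nat, forall x, psi x != 0 -> forall i, `|x i 0| <= L%:R.
Proof.
move=> [_ /compact_bounded [b [_ /(_ (`|b| + 1))]]] hb.
exists (Num.bound (`|b| + 1)) => x px i.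
have xi : `|x i 0| <= `|x|.
  rewrite -[leRHS]/(mx_norm x) mx_normrE; apply/bigmax_geP; right.
  by exists (i, 0).
apply: (le_trans xi); apply: (@le_trans _ _ (`|b| + 1)).
  apply: hb; last exact: subset_closure.
  by rewrite (le_lt_trans (ler_norm b))// ltrDl.
by apply/ltW/archi_boundP; rewrite addr_ge0.
Qed.

(** The number of lattice translates of t that meet the support is bounded independently of t. This
    uniformity is what makes the supremum in [Xinorm] finite on [Cc]. *)
Lemma Cc_sqterm_bounded psi : Cc psi ->
  exists M, forall t J, partial_sum (sqterm psi t) J <= M.
Proof.
move=> Cpsi; have [b psib] := Cc_modulus_bounded Cpsi.
have [L psiL] := Cc_support_bounded Cpsi.
(* [psi (t - p)] vanishes unless p is within L + 1 of the integer part of t. *)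
pose e (f : {ffun 'I_n -> 'I_(L.+1.*2.+1)}) : 'cV[int]_n :=
  \col_i ((f i)%:Z - L.+1%:Z).
pose T0 := [fset e f | f in [set: {ffun 'I_n -> 'I_(L.+1.*2.+1)}]%SET]%fset.
exists (b ^+ 2 *+ #|` T0|) => t J.
pose fl : 'cV[int]_n := \col_i Num.floor (t i 0).
pose T := [fset (fl + m)%R | m in T0]%fset.
(* [T] is the translate by [fl] of [T0], and [T0] does not depend on t. *)
apply: (@le_trans _ _ (b ^+ 2 *+ #|` T|)); last first.
  by rewrite ler_wpMn2l ?sqr_ge0 // leq_imfset_card.
apply: partial_sum_le_card => p.
  rewrite sqterm_ge0 /= lerXn2r ?nnegrE ?modulus_ge0 //.
  by rewrite (le_trans _ (psib t)) // modulus_ge0.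
apply: contraNeq => sq0.
have /psiL tpL : psi (t - lattice p) != 0.
  by apply: contraNneq sq0; rewrite /sqterm => ->; rewrite /modulus normr0 expr0n.
have pfl i : `|p i 0 - fl i 0| <= L.+1%:Z.
  have := tpL i; rewrite !mxE ler_norml -mulNrn => /andP[tp1 tp2].
  have := floor_le (t i 0); have := floorD1_gt (t i 0).
  rewrite intrD => f1 f2.
  have hL : (L.+1%:Z)%:~R = L%:R + 1 :> R by rewrite natr1.
  rewrite ler_norml -!(ler_int R) intrN hL intrB.
  move: f1; rewrite [1%:~R]mulr1z => f1.
  apply/andP; split; lra.
apply/imfsetP; exists (p - fl); last by rewrite /= addrC subrK.
apply/imfsetP => /=.
have lt_i i : (absz (p i 0 - fl i 0 + L.+1%:Z)%R < L.+1.*2.+1)%N.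
  have := pfl i; lia.
exists [ffun i => Ordinal (lt_i i)]; first by rewrite inE.
apply/matrixP => i j; rewrite (ord1 j) [RHS]mxE ffunE /= mxE [(- fl) i 0]mxE.
rewrite gez0_abs ?addrK // -lerBlDr sub0r.
by move: (pfl i); rewrite ler_norml => /andP[].
Qed.

Lemma CcB phi psi : Cc phi -> Cc psi -> Cc (phi - psi).
Proof.
move=> [cphi Kphi] [cpsi Kpsi]; split.
  by move=> x; exact: (@cvgB _ C _ _ _ _ _ _ _ (cphi x) (cpsi x)).
apply: subclosed_compact (compactU Kphi Kpsi) _; first exact: closed_closure.
rewrite -closureU; apply: closureS => x /= phipsi.
have [phi0|] := eqVneq (phi x) 0; last by left.
right; apply: contraNneq phipsi => psi0.
by rewrite /GRing.add /GRing.opp /= phi0 psi0 subrr.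
Qed.

(** The terms of [inner psi psi t] are squared moduli, so its value is the supremum of the partial
    sums, expressed here as a least upper bound. *)
Lemma Cc_inner psi t : Cc psi ->
  exists s, [/\ inner psi psi t = s%:C%C,
    forall J, partial_sum (sqterm psi t) J <= s
    & forall M, (forall J, partial_sum (sqterm psi t) J <= M) -> s <= M].
Proof.
move=> Cpsi; have [M psiM] := Cc_sqterm_bounded Cpsi.
have [s [has_s sM]] := has_sum_ge0 (sqterm_ge0 psi t) (psiM t).
exists s; split => [|J|M' psiM']; last 2 first.
- by have /andP[] := sM J.
- have [s' [has_s' /(_ fset0)/andP[_ s'M']]] := has_sum_ge0 (sqterm_ge0 psi t) psiM'.
  by rewrite -(has_sum_sum has_s) (has_sum_sum has_s').
apply: has_sum_sum; rewrite /has_sum.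
have -> : partial_sum (fun p : 'cV[int]_n =>
    (psi (t - lattice p) : C)^* * psi (t - lattice p)) =
    (fun J => (partial_sum (sqterm psi t) J)%:C%C : C).
  apply/funext => J; rewrite !partial_sumE rmorph_sum; apply: eq_bigr => p _.
  exact: conjM_modulus.
exact: (continuous_cvg _ (@real_complex_continuous _ _) has_s).
Qed.

(** By the uniform bound of [Cc_sqterm_bounded], the supremum in [Xinorm] is taken over a bounded
    set, hence dominates every value of [inner psi psi]. *)
Lemma Cc_sqterm_le_Xinorm psi t J : Cc psi ->
  partial_sum (sqterm psi t) J <= Xinorm psi ^+ 2.
Proof.
move=> Cpsi; have [M psiM] := Cc_sqterm_bounded Cpsi.
set S := range (fun t => modulus (inner psi psi t)).
have S_ge u J' : partial_sum (sqterm psi u) J' <= sup S.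
  have [s [es sJ sM]] := Cc_inner u Cpsi.
  apply: le_trans (sJ J') _; apply: (le_trans (ler_norm s)).
  apply: ub_le_sup; last first.
    by exists u => //; apply: complexI; rewrite modulusE es normc_def /=
      expr0n addr0 sqrtr_sqr.
  exists M => _ [v _ <-]; have [s' [es' s'J s'M]] := Cc_inner v Cpsi.
  apply: le_trans (s'M _ (psiM v)); rewrite es' -lecR modulusE.
  rewrite ger0_norm // ler0c (le_trans _ (s'J fset0)) //.
  by rewrite partial_sumE big_seq_fset0.
rewrite [Xinorm psi](_ : _ = Num.sqrt (sup S)) // sqr_sqrtr //.
by have := S_ge t fset0; rewrite partial_sumE big_seq_fset0.
Qed.

(* Fatou: a finite sum for xi - phi N is the limit of the ones for phi k - phi N,
   which are bounded by the Cauchy property. *)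
Lemma Xi_sq_summable xi t : Xi xi ->
  exists M, forall J, partial_sum (sqterm xi t) J <= M.
Proof.
move=> [phi [Cphi cauchy phixi]].
have [N phiN] := cauchy 1 ltr01.
have [M phiM] := Cc_sqterm_bounded (Cphi N).
have le1 J : partial_sum (sqterm (xi - phi N) t) J <= 1.
  suff : (fun k => partial_sum (sqterm (phi k - phi N) t) J) @ \oo -->
      partial_sum (sqterm (xi - phi N) t) J.
    apply: (closed_cvg _ (@closed_le R 1)).
    exists N => // k /= Nk.
    apply: le_trans (Cc_sqterm_le_Xinorm _ _ (CcB (Cphi k) (Cphi N))) _.
    by rewrite exprn_ile1 ?sqrtr_ge0 // ltW // phiN.
  under eq_cvg do rewrite partial_sumE.
  rewrite partial_sumE.
  apply: (cvg_big (@add_continuous R)) => p _.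
  apply: (@cvg_comp _ _ _ _ (fun x => x ^+ 2)); last exact: exprn_continuous.
  apply: continuous_cvg; first exact: modulus_continuous.
  by apply: (@cvgB _ C _ _ _ _ (fun=> phi N (t - lattice p)));
    [exact: phixi | exact: cvg_cst].
(* From (a + b)^2 <= 2 a^2 + 2 b^2, applied to xi = (xi - phi N) + phi N. *)
exists (2 * 1 + 2 * M) => J.
apply: (@le_trans _ _ (2 * partial_sum (sqterm (xi - phi N) t) J +
    2 * partial_sum (sqterm (phi N) t) J)); last by rewrite lerD // ler_pM2l.
rewrite !partial_sumE !mulr_sumr -big_split /=; apply: ler_sum => p _.
rewrite /sqterm; set x := t - lattice p.
have := modulusD (xi x - phi N x : C) (phi N x); rewrite subrK.
have := modulus_ge0 (xi x : C); have := modulus_ge0 (phi N x : C).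
rewrite [(xi - phi N) x](_ : _ = xi x - phi N x) //.
move: (modulus _) (modulus _) (modulus _) => a b c a0 b0 bca.
have := sqr_ge0 (a - c); nra.
Qed.

(** Square summability of both functions and a b <= a^2 + b^2 give absolute convergence, so that
    [inner] is a genuine sum on [Xi]. *)
Lemma Xi_inner eta xi t : Xi eta -> Xi xi ->
  has_sum (fun p : 'cV[int]_n =>
    (eta (t - lattice p) : C)^* * xi (t - lattice p)) (inner eta xi t).
Proof.
move=> /(Xi_sq_summable t) [M etaM] /(Xi_sq_summable t) [M' xiM].
suff [s has_s] : exists s, has_sum (fun p : 'cV[int]_n =>
    (eta (t - lattice p) : C)^* * xi (t - lattice p)) s.
  by rewrite [inner _ _ _](has_sum_sum has_s).
apply: (@cvg_modulus_summable _ _ _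
  (fun p => sqterm eta t p + sqterm xi t p) (M + M')) => [p|J].
  rewrite modulusM modulus_conj /sqterm.
  move: (modulus_ge0 (eta (t - lattice p) : C)) (modulus_ge0 (xi (t - lattice p) : C)).
  move: (modulus _) (modulus _) => a b a0 b0; nra.
by rewrite partial_sumE big_split /= -!partial_sumE lerD.
Qed.

End SquareSummability.

(** * The quotient of Z^n by M Z^n *)

Section IntegerLattice.
Variable n : nat.
Implicit Types (M : 'M[int]_n) (u v w p : 'cV[int]_n).

(* [sec] enumerates representatives of Z^n / M Z^n and [red] gives the class of
   a vector. *)
Definition quotient_by M (N : nat) (sec : 'I_N -> 'cV[int]_n)
    (red : 'cV[int]_n -> 'I_N) :=
  cancel sec red /\ forall u v, red u = red v <-> exists w, u = v + M *m w.

Lemma unitmx_int_absz (L : 'M[int]_n) : L \in unitmx -> absz (\det L) = 1%N.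
Proof.
rewrite unitmxE => /unitrP[y [yL _]]; have := congr1 absz yL.
by rewrite abszM => /eqP; rewrite muln_eq1 => /andP[_ /eqP].
Qed.

(** In the Smith normal form M = L D P, with L and P invertible over Z, the map L^-1 identifies Z^n
    / M Z^n with the product [G] of the Z / d_i, whose order is the product of the |d_i|, that is
    |det M|. *)
Lemma exists_quotient_by M : \det M != 0 ->
  exists sec red, @quotient_by M (absz (\det M)) sec red.
Proof.
move=> detM0; have [L Lu [P Pu [d _ ML]]] := int_Smith_normal_form M.
set D := \matrix_(i, j) _ in ML.
have DE : D = diag_mx (\row_i d`_i).
  by apply/matrixP => i j; rewrite !mxE.
have detD : \det D = \prod_(i < n) d`_i.
  by rewrite DE det_diag; apply: eq_bigr => i _; rewrite mxE.
have detME : absz (\det M) = (\prod_(i < n) absz (d`_i)%R)%N.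
  rewrite ML !det_mulmx !abszM (unitmx_int_absz Lu) (unitmx_int_absz Pu) mul1n muln1 detD.
  by rewrite (big_morph absz abszM absz1).
have d_neq0 (i : 'I_n) : d`_i != 0.
  move: detM0; rewrite -absz_eq0 detME; apply: contraNneq => di0.
  by rewrite (bigD1 i) //= di0 mul0n.
pose G := {dffun forall i : 'I_n, 'I_(absz (d`_i)%R)}.
have cardG : absz (\det M) = #|G|.
  rewrite detME card_dep_ffun foldrE big_map big_enum /=.
  by apply: eq_bigr => i _; rewrite card_ord.
have mod_lt (a : int) (i : 'I_n) : (absz (a %% (d`_i)%R)%Z < absz (d`_i)%R)%N.
  by rewrite -ltz_nat (gez0_abs (modz_ge0 a (d_neq0 i))) abszE ltz_mod.
pose sec (g : G) : 'cV[int]_n := L *m \col_i (nat_of_ord (g i))%:Z.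
pose red (u : 'cV[int]_n) : G :=
  finfun (fun i : 'I_n => Ordinal (mod_lt ((invmx L *m u) i 0) i)).
have secK : cancel sec red.
  move=> g; apply/ffunP => i; apply: val_inj; rewrite ffunE /= mulKmx // mxE.
  by rewrite -modz_abs modz_small // ltz_nat ltn_ord.
have DwE w i : (D *m w) i 0 = d`_i * w i 0.
  by rewrite DE mul_diag_mx !mxE.
have redP u v : red u = red v <-> exists w, u = v + M *m w.
  split=> [ruv | [w ->]].
    (* Equal residues make the i-th coordinate of L^-1 (u - v) divisible by d_i; [w0] is D^-1 L^-1
       (u - v), and w = P^-1 w0. *)
    pose w0 : 'cV[int]_n :=
      \col_i (((invmx L *m u) i 0 - (invmx L *m v) i 0)%R %/ (d`_i)%R)%Z.
    exists (invmx P *m w0); rewrite ML -!mulmxA mulKVmx //.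
    apply/eqP; rewrite addrC -subr_eq; apply/eqP.
    rewrite -[LHS](mulKVmx Lu); congr (_ *m _).
    apply/matrixP => i j; rewrite (ord1 j) DwE mulmxBr !mxE mulrC divzK //.
    rewrite -eqz_mod_dvd; apply/eqP.
    have := congr1 (fun g : G => Posz (nat_of_ord (g i))) ruv.
    by rewrite !ffunE /= !(gez0_abs (modz_ge0 _ (d_neq0 i))) !mxE.
  apply/ffunP => i; apply: val_inj; rewrite !ffunE /=; congr absz.
  by rewrite mulmxDr ML -!mulmxA mulKmx // mxE DwE addrC mulrC modzMDl.
rewrite cardG; exists (sec \o enum_val), (enum_rank \o red); split.
  by move=> q /=; rewrite secK enum_valK.
move=> u v; rewrite -redP /=; split=> [|-> //]; exact: enum_rank_inj.
Qed.

(** Translation by p permutes the classes modulo M Z^n. *)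
Lemma quotient_by_shift M N sec red (V : nmodType) (f : 'cV[int]_n -> V) p :
  @quotient_by M N sec red -> (forall u w, f (u + M *m w) = f u) ->
  \sum_q f (sec q + p) = \sum_q f (sec q).
Proof.
move=> [secK redP] fM.
rewrite [RHS](reindex_inj (h := fun q => red (sec q + p))) /=.
  apply: eq_bigr => q _.
  by have /redP[w {1}->] := esym (secK (red (sec q + p))); rewrite fM.
move=> q q' /redP[w]; rewrite addrAC => /addIr e.
by rewrite -(secK q) -(secK q'); apply/redP; exists w.
Qed.

End IntegerLattice.

(** * Characters *)

Section Characters.
Variable R : realType.
Local Notation C := (cplx R).

(** This is e(r), the exponential of 2 pi i r. *)
Definition cis (r : R) : C := (cos (pi *+ 2 * r) +i* sin (pi *+ 2 * r))%C.

Lemma cisD r s : cis (r + s) = cis r * cis s.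
Proof.
rewrite /cis mulrDr cosD sinD [RHS]/GRing.mul /=.
by rewrite [sin _ * _ + _]addrC.
Qed.

Lemma cis0 : cis 0 = 1.
Proof. by rewrite /cis mulr0 cos0 sin0. Qed.

Lemma cisNK r : cis (- r) * cis r = 1.
Proof. by rewrite -cisD addNr cis0. Qed.

Lemma cis_neq0 r : cis r != 0.
Proof.
by apply/negP => /eqP e; have /eqP := cisNK r; rewrite e mulr0 eq_sym oner_eq0.
Qed.

Lemma conj_cis r : (cis r)^* = cis (- r).
Proof. by rewrite /cis mulrN cosN sinN. Qed.

Lemma cis_nat m : cis m%:R = 1.
Proof.
elim: m => [|m IH]; first exact: cis0.
by rewrite -natr1 cisD IH mul1r /cis mulr1 cos2pi sin2pi.
Qed.

Lemma cis_int (z : int) : cis z%:~R = 1.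
Proof.
case: z => m; first exact: cis_nat.
by have := cisNK m.+1%:R; rewrite cis_nat mulr1 NegzE intrN.
Qed.

(** The fractional part s of r also satisfies [cis s = 1]. Then cos (2 pi s) = 1 gives sin (pi s) =
    0, and the positivity of sin between 0 and pi forces s = 0. *)
Lemma cis_eq1 r : cis r = 1 -> exists z : int, r = z%:~R.
Proof.
move=> r1; exists (Num.floor r); apply/eqP; rewrite -subr_eq0.
set s := r - _.
have s1 : cis s = 1 by rewrite cisD r1 -intrN cis_int mulr1.
have s_ge0 : 0 <= s by rewrite subr_ge0 floor_le.
have s_lt1 : s < 1.
  by have := floorD1_gt r; rewrite intrD [1%:~R]mulr1z ltrBlDl.
have [cos1 _] : cos (pi *+ 2 * s) = 1 /\ sin (pi *+ 2 * s) = 0.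
  by have := congr1 (@complex.Re R) s1; have := congr1 (@complex.Im R) s1.
have : sin (pi * s) ^+ 2 = 0.
  by move: cos1; rewrite mulrnAl cos_mulr2n sin2cos2; lra.
move=> /eqP; rewrite sqrf_eq0; apply: contraTT => s0.
rewrite gt_eqF // sin_gt0_pi //; have := pi_gt0 R => pi0.
rewrite gtr_pMr // s_lt1 andbT mulr_gt0 //.
by rewrite lt_def s0.
Qed.

Lemma cis_continuous : continuous cis.
Proof.
move=> r.
have lin : continuous (fun x : R => pi *+ 2 * x) by exact: mulrl_continuous.
apply: (@cvg_complex _ _ _ _ cis); rewrite /cis /=.
  by apply: (continuous_comp (lin r)); exact: continuous_cos.
by apply: (continuous_comp (lin r)); exact: continuous_sin.
Qed.

Lemma mx_continuous (T : topologicalType) (m n : nat) (f : T -> 'M[R]_(m, n)) :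
  (forall i j, continuous (fun x => f x i j)) -> continuous f.
Proof.
move=> cf x A [P fP PA]; apply: (@filterS _ (nbhs x) _
  [set y | forall ij : 'I_m * 'I_n, P ij.1 ij.2 (f y ij.1 ij.2)]).
  by move=> y Py; apply: PA => i j; exact: (Py (i, j)).
by apply: filter_forall => -[i j]; exact: (cf i j x _ (fP i j)).
Qed.

Lemma mulmx_continuous (m n p : nat) (A : 'M[R]_(m, n)) :
  continuous (fun x : 'M[R]_(n, p) => A *m x).
Proof.
apply: mx_continuous => i j; under eq_fun do rewrite mxE.
apply: (continuous_big (@add_continuous R)) => k _ x.
apply: (@continuous_comp _ _ _ (fun y : 'M[R]_(n, p) => y k j) ( *%R (A i k))).
  exact: coord_continuous.
exact: mulrl_continuous.
Qed.

Variable n : nat.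
Local Notation lattice := (lattice R).
Implicit Types (k l u v w p : 'cV[int]_n) (x y : 'cV[R]_n).

(** The character e(k . x) of T^n, the dot product being the entry of a 1 x 1 matrix. *)
Definition chi k x : C := cis (((lattice k)^T *m x) 0 0).

Lemma chiDr k x y : chi k (x + y) = chi k x * chi k y.
Proof. by rewrite /chi mulmxDr mxE cisD. Qed.

Lemma chiBr (k : 'cV[int]_n) x y : chi k (x - y) = chi k x * (chi k y)^*.
Proof. by rewrite chiDr; congr (_ * _); rewrite /chi mulmxN mxE conj_cis. Qed.

Lemma chiDl k l x : chi (k + l) x = chi k x * chi l x.
Proof. by rewrite /chi /lattice map_mxD linearD mulmxDl mxE cisD. Qed.

Lemma chiNl k x : chi (- k) x = (chi k x)^*.
Proof. by rewrite /chi /lattice map_mxN linearN mulNmx mxE conj_cis. Qed.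

Lemma chi0l x : chi 0 x = 1.
Proof. by rewrite /chi /lattice map_mx0 trmx0 mul0mx mxE cis0. Qed.

Lemma chi_conjK k x : (chi k x)^* * chi k x = 1.
Proof. by rewrite conj_cis cisNK. Qed.

Lemma chi_lattice k p : chi k (lattice p) = 1.
Proof. by rewrite /chi /lattice map_trmx -map_mxM mxE cis_int. Qed.

Lemma chi_torus k : chi k \in @torus_fun R n.
Proof.
apply/asboolP; split.
  move=> x; apply: continuous_comp; last exact: cis_continuous.
  apply: (@continuous_comp _ _ _ _ (fun y : 'M[R]_1 => y 0 0)).
    exact: mulmx_continuous.
  exact: coord_continuous.
move=> t p; rewrite -[in RHS](subrK (lattice p) t) [RHS]chiDr chi_lattice.
by rewrite mulr1.
Qed.

(** The pairing e(k . M^-1 u) between Z^n / M^T Z^n and Z^n / M Z^n is symmetric up to transposing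
    M, so facts about sums over u also serve for sums over k. *)
Lemma chi_tr_invmx (M : 'M[int]_n) k u :
  chi k (invmx (map_mx intr M) *m lattice u) =
  chi u (invmx (map_mx intr M^T) *m lattice k).
Proof.
rewrite /chi -[map_mx intr M^T]map_trmx -trmx_inv.
by rewrite -{2}(trmxK (lattice k)) -!trmx_mul [in RHS]mxE mulmxA.
Qed.

(** Orthogonality of characters: f(u) = e(k . M^-1 u) is a character of Z^n / M Z^n. If f p differs
    from 1, shifting by p multiplies the sum by f p without changing it, so it vanishes. If f is
    constantly 1, its values at the basis vectors show that the coordinates of (M^T)^-1 k are
    integers. *)
Lemma sum_chi (M : 'M[int]_n) N sec red k : @quotient_by n M N sec red ->
  \det M != 0 ->
  \sum_q chi k (invmx (map_mx intr M) *m lattice (sec q)) =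
  if `[< exists w, k = M^T *m w >] then N%:R else 0.
Proof.
move=> quoM detM.
have Mu : (map_mx intr M : 'M[R]_n) \in unitmx.
  by rewrite unitmxE det_map_mx unitfE intr_eq0.
pose f u := chi k (invmx (map_mx intr M) *m lattice u).
have fD u v : f (u + v) = f u * f v by rewrite /f /lattice map_mxD mulmxDr chiDr.
have fM w : f (M *m w) = 1.
  by rewrite /f /lattice map_mxM mulKmx // chi_lattice.
case: asboolP => [[w kw]|kM].
  rewrite (eq_bigr (fun=> 1)) ?big_const_ord ?iter_addr_0 // => q _.
  by rewrite chi_tr_invmx kw /lattice map_mxM mulKmx -?map_trmx ?unitmx_tr // chi_lattice.
have [p fp] : exists p, f p != 1.
  apply: contra_notP kM => allf.
  have f1 p : f p = 1 by apply/eqP; apply: contra_notT allf; exists p.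
  have /choice[z zE] i :
      exists z : int, (invmx (map_mx intr M^T) *m lattice k) i 0 = z%:~R.
    apply: cis_eq1; rewrite -[RHS](f1 (delta_mx i 0)).
    rewrite /f chi_tr_invmx /chi; congr cis.
    by rewrite /lattice map_delta_mx trmx_delta -rowE [RHS]mxE.
  exists (\col_i z i).
  suff kE : lattice k = lattice (M^T *m \col_i z i).
    apply/matrixP => i j; apply: (@intr_inj R).
    by have := congr1 (fun x => x i j) kE; rewrite [LHS]mxE [RHS]mxE.
  have MTu : map_mx intr M^T \in @unitmx R n by rewrite -map_trmx unitmx_tr.
  rewrite /lattice map_mxM -[LHS](mulKVmx MTu); congr (_ *m _).
  by apply/matrixP => i j; rewrite (ord1 j) zE !mxE.
have fMD u w : f (u + M *m w) = f u by rewrite fD fM mulr1.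
have := quotient_by_shift p quoM fMD; under eq_bigr do rewrite fD.
rewrite -mulr_suml => /eqP; rewrite -subr_eq0 -{2}[\sum_q _]mulr1 -mulrBr.
by rewrite mulf_eq0 subr_eq0 (negPf fp) orbF => /eqP.
Qed.

End Characters.

(** * Dilations and inner products *)

Section DilatedInner.
Variables (R : realType) (n : nat).
Local Notation C := (cplx R).
Local Notation lattice := (lattice R).
Local Notation funRn := (funRn R n).
Local Notation CT := (CT R n).
Implicit Types (M : 'M[int]_n) (xi eta : funRn) (t x : 'cV[R]_n) (g h : CT).

Lemma intmx_unit M : \det M != 0 -> (map_mx intr M : 'M[R]_n) \in unitmx.
Proof. by move=> M0; rewrite unitmxE det_map_mx unitfE intr_eq0. Qed.

(** Common form of the powers D^i with i >= 0, where M = (A^T)^i; see [iter_Dil]. *)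
Definition dil (c : C) M xi : funRn :=
  fun x => c * xi (invmx (map_mx intr M) *m x).

(** Each lattice point is uniquely sec q + M m, and M^-1 (t - sec q - M m) = M^-1 (t - sec q) - m.
    The fibre over q thus gives an inner product at M^-1 (t - sec q). *)
Lemma inner_dil c M N sec red eta xi t : \det M != 0 ->
  @quotient_by n M N sec red -> Xi eta -> Xi xi ->
  inner (dil c M eta) (dil c M xi) t = c^* * c *
    \sum_q (inner eta xi (invmx (map_mx intr M) *m (t - lattice (sec q))) : C).
Proof.
move=> M0 [secK redP] Xeta Xxi; apply: has_sum_sum.
have Mu := intmx_unit M0.
have /choice[quo quoE] u : exists w, u = sec (red u) + M *m w.
  by apply/redP; rewrite secK.
rewrite mulr_sumr; apply: (@has_sum_fibers _ _ _ _ red quo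
    (fun q (m : 'cV[int]_n) => sec q + M *m m)) => [q m m' /addrI e|q m|p|q].
- apply/matrixP => i j; apply: (@intr_inj R).
  have : lattice m = lattice m'.
    by rewrite -[LHS](mulKmx Mu) -map_mxM e map_mxM mulKmx.
  by move=> /(congr1 (fun x => x i j)); rewrite [LHS]mxE [RHS]mxE.
- by rewrite -[RHS]secK; apply/redP; exists m.
- by rewrite -quoE.
- set s := invmx _ *m _.
  have -> : (fun m => (dil c M eta (t - lattice (sec q + M *m m)))^* *
      dil c M xi (t - lattice (sec q + M *m m))) =
    (fun m => c^* * c * ((eta (s - lattice m) : C)^* * xi (s - lattice m))).
    apply/funext => m; rewrite /dil.
    have -> : invmx (map_mx intr M) *m (t - lattice (sec q + M *m m)) =
        s - lattice m.
      by rewrite /lattice map_mxD opprD addrA mulmxBr map_mxM mulKmx.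
    by rewrite rmorphM /=; ring.
  rewrite /has_sum.
  have -> : partial_sum (fun m => c^* * c * ((eta (s - lattice m) : C)^* *
        xi (s - lattice m))) = (fun J => c^* * c * partial_sum
          (fun m => (eta (s - lattice m) : C)^* * xi (s - lattice m)) J).
    by apply/funext => J; rewrite !partial_sumE mulr_sumr.
  apply: (@cvgM C _ _ _ (fun=> c^* * c)); first exact: cvg_cst.
  exact: Xi_inner.
Qed.

Lemma torus_funP g : continuous (g : 'cV[R]_n -> C) /\
  forall t (p : 'cV[int]_n), g (t - lattice p) = g t.
Proof. by have := valP g => /asboolP. Qed.

Lemma torus_funD g t p : g (t + lattice p) = g t.
Proof. by rewrite -((torus_funP g).2 _ p) addrK. Qed.

Lemma innerZl g eta xi t : Xi eta -> Xi xi ->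
  inner (g *: eta) xi t = (g t)^* * inner eta xi t :> C.
Proof.
move=> Xeta Xxi; apply: has_sum_sum; rewrite /has_sum.
have -> : partial_sum (fun m : 'cV[int]_n => ((g *: eta) (t - lattice m) : C)^* *
      xi (t - lattice m)) = (fun J => (g t)^* * partial_sum
        (fun m => (eta (t - lattice m) : C)^* * xi (t - lattice m)) J).
  apply/funext => J; rewrite !partial_sumE mulr_sumr; apply: eq_bigr => m _.
  by rewrite [(g *: eta) _]/(g _ * _) (torus_funP g).2 rmorphM /= mulrA.
apply: (@cvgM C _ _ _ (fun=> (g t)^*)); first exact: cvg_cst.
exact: Xi_inner.
Qed.

Definition chiCT k : CT := MkCT (chi_torus R k).

(** The second orthogonality relation, summing over characters at a fixed difference of classes: it
    is [sum_chi] for M^T, read through [chi_tr_invmx]. *)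
Lemma sum_chi_dual M N sec red N' sec' red' q q0 : \det M != 0 ->
  @quotient_by n M N sec red -> @quotient_by n M^T N' sec' red' ->
  \sum_k chi (sec' k) (invmx (map_mx intr M) *m lattice (sec q - sec q0)) =
  if q == q0 then N'%:R else 0 :> C.
Proof.
move=> M0 [secK redP] quo'; under eq_bigr do rewrite chi_tr_invmx.
rewrite (sum_chi _ _ quo') ?det_tr // trmxK; congr (if _ then _ else _).
apply/asboolP/eqP => [[w e]|->]; last by exists 0; rewrite subrr mulmx0.
by rewrite -(secK q) -(secK q0); apply/redP; exists w; rewrite -e addrC subrK.
Qed.

(* For the converse inclusion, V0 is stable under the characters of R^n / Z^n, and
   replacing eta by [chi k] eta for all k separates the terms of the sum over
   Z^n / M Z^n given by [inner_dil]. *)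
Lemma ominus_dil c M (V1 V0 : set funRn) : \det M != 0 -> c != 0 ->
  V1 `<=` @Xi R n -> V0 `<=` @Xi R n -> (forall g eta, V0 eta -> V0 (g *: eta)) ->
  ominus (dil c M @` V1) (dil c M @` V0) = dil c M @` ominus V1 V0.
Proof.
move=> M0 c0 V1Xi V0Xi V0scale.
have [sec [red quo]] := exists_quotient_by M0.
have [|sec' [red' quo']] := @exists_quotient_by n M^T; first by rewrite det_tr.
have Mu := intmx_unit M0.
apply/seteqP; split=> [_ [[xi V1xi <-] orth]|_ [xi [V1xi orth] <-]]; last first.
  split; first by exists xi.
  move=> _ [eta V0eta <-]; apply/funext => t.
  rewrite (inner_dil _ _ M0 quo (V0Xi _ V0eta) (V1Xi _ V1xi)).
  by rewrite big1 ?mulr0 // => q _; rewrite orth.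
exists xi => //; split => // eta V0eta; apply/funext => s.
(* The point t is chosen so that the term of index [q0] is evaluated at s; the representative
   [sec q0] may differ from 0. *)
pose q0 := red 0; pose t := map_mx intr M *m s + lattice (sec q0).
pose u q := invmx (map_mx intr M) *m (t - lattice (sec q)).
have uq0 : u q0 = s by rewrite /u /t addrK mulKmx.
have chi_u k q : chi k (u q) = chi k (invmx (map_mx intr M) *m t) *
    (chi k (invmx (map_mx intr M) *m lattice (sec q)))^*.
  by rewrite /u mulmxBr chiBr.
(* Orthogonality against [chi k] eta, after cancelling c^* c and the conjugate of chi k (M^-1 t),
   which does not depend on q. *)
have Ik k : \sum_q chi k (invmx (map_mx intr M) *m lattice (sec q)) *
    (inner eta xi (u q) : C) = 0.
  have /(congr1 (fun f : funRn => f t)) := orth _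
    (imageP (dil c M) (V0scale (chiCT k) _ V0eta)).
  rewrite (inner_dil _ _ M0 quo (V0Xi _ (V0scale (chiCT k) _ V0eta)) (V1Xi _ V1xi)).
  move=> /eqP; rewrite !mulf_eq0 conjC_eq0 (negPf c0) /= => /eqP.
  under eq_bigr => q _ do rewrite (innerZl _ _ (V0Xi _ V0eta) (V1Xi _ V1xi)) -/(u q)
    [chiCT k (u q)](chi_u k q) rmorphM /= conjCK -mulrA.
  rewrite -mulr_sumr => /eqP; rewrite mulf_eq0 conjC_eq0 (negPf (cis_neq0 _)) /=.
  by move=> /eqP.
(* Fourier inversion: weighting the relations [Ik] by conjugate characters at [q0] leaves |det M|
   times the term at [q0]. *)
have : \sum_k (chi (sec' k) (invmx (map_mx intr M) *m lattice (sec q0)))^* *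
    \sum_q chi (sec' k) (invmx (map_mx intr M) *m lattice (sec q)) *
    (inner eta xi (u q) : C) = 0.
  by rewrite big1 // => k _; rewrite Ik mulr0.
under eq_bigr do rewrite mulr_sumr.
rewrite exchange_big /= (bigD1 q0) //= [X in _ + X]big1 => [|q qq0].
  under eq_bigr do rewrite mulrA chi_conjK mul1r.
  rewrite sumr_const card_ord addr0 uq0 -mulr_natl => /eqP.
  by rewrite mulf_eq0 pnatr_eq0 det_tr absz_eq0 (negPf M0) => /eqP.
under eq_bigr do rewrite mulrA [_^* * _]mulrC -chiBr -mulmxBr -map_mxB.
by rewrite -mulr_suml (sum_chi_dual _ _ M0 quo quo') (negPf qq0) mul0r.
Qed.

End DilatedInner.

(** * Dilations and free modules *)

Section DilatedFree.
Variables (R : realType) (n : nat).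
Local Notation C := (cplx R).
Local Notation lattice := (lattice R).
Local Notation CT := (CT R n).
Variables (M : 'M[int]_n) (N : nat).
(** [sec] lists the translations to average over and [sec'] the frequencies of the basis characters.
    One N serves both, since M and M^T have the same determinant. *)
Variables (sec : 'I_N -> 'cV[int]_n) (red : 'cV[int]_n -> 'I_N).
Variables (sec' : 'I_N -> 'cV[int]_n) (red' : 'cV[int]_n -> 'I_N).
Hypotheses (M0 : \det M != 0) (quo : quotient_by M sec red)
  (quo' : quotient_by M^T sec' red') (N0 : (0 < N)%N).
Implicit Types (g a : CT) (t x y : 'cV[R]_n) (h : 'I_N -> CT).

Local Notation MR := (map_mx intr M : 'M[R]_n).

Lemma CTvalM g1 g2 x : (g1 * g2) x = g1 x * g2 x :> C. Proof. by []. Qed.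
Lemma CTval_sum (I : finType) (F : I -> CT) x :
  (\sum_i F i) x = \sum_i F i x :> C.
Proof. by apply: (big_morph (fun g : CT => g x : C)). Qed.

(** M is integral, so it maps Z^n into itself. *)
Fact pullback_torus g : (fun x => g (MR *m x)) \in @torus_fun R n.
Proof.
apply/asboolP; split=> [x|t p].
  apply: (@continuous_comp _ _ _ (mulmx MR) g); first exact: mulmx_continuous.
  exact: (torus_funP g).1.
by rewrite mulmxBr -map_mxM [LHS](torus_funP g).2.
Qed.

Definition pullback g : CT := MkCT (pullback_torus g).

Lemma pullbackE g x : pullback g x = g (MR *m x) :> C. Proof. by []. Qed.

Lemma chiCTE k x : chiCT R k x = chi k x :> C. Proof. by []. Qed.

(** The linear combination of the characters of frequencies [sec' k] with coefficients h_k(M x).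
    That these characters form a basis over the image of [pullback] is the content of [recomposeK]
    and [componentK]. *)
Definition recompose h : CT := \sum_k pullback (h k) * chiCT R (sec' k).

(** The product of g with the conjugate of [chi k], rescaled by M^-1. It is only M Z^n-periodic in
    general; averaging over Z^n / M Z^n restores Z^n-periodicity. *)
Definition twist g (k : 'cV[int]_n) x : C :=
  g (invmx MR *m x) * (chi k (invmx MR *m x))^*.

Lemma twist_lattice g k x w : twist g k (x + lattice (M *m w)) = twist g k x.
Proof.
rewrite /twist mulmxDr /lattice map_mxM mulKmx ?intmx_unit //.
by rewrite torus_funD chiDr chi_lattice mulr1.
Qed.

Lemma twist_continuous g k : continuous (twist g k).
Proof.
have cinv : continuous (mulmx (invmx MR) : 'cV_n -> 'cV_n) by exact: mulmx_continuous.
have comp_inv (f : CT) : continuous (fun x => f (invmx MR *m x) : C).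
  move=> x; apply: (@continuous_comp _ _ _ (mulmx (invmx MR)) f); first exact: cinv.
  exact: (torus_funP f).1.
move=> x; apply: (@cvgM C _ _ _ _ _ _ _ (comp_inv g x)).
under eq_fun do rewrite -chiNl.
by rewrite -chiNl; exact: (comp_inv (chiCT R (- k))).
Qed.

Fact component_torus g (k : 'I_N) :
  (fun y => N%:R^-1 * \sum_q twist g (sec' k) (y + lattice (sec q)))
    \in @torus_fun R n.
Proof.
apply/asboolP; split=> [x|t p].
  apply: (@continuous_comp _ _ _
    (fun y => \sum_q twist g (sec' k) (y + lattice (sec q))) ( *%R (N%:R^-1 : C))).
    have ctw q : continuous (fun y => twist g (sec' k) (y + lattice (sec q)) : C).
      move=> {}x; apply: (@continuous_comp _ _ _ (fun y : 'cV[R]_n => y + lattice (sec q))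
        (twist g (sec' k))).
        by apply: (@cvgD _ 'cV[R]_n _ (nbhs x) _ id (fun=> lattice (sec q)));
          [exact: cvg_id | exact: cvg_cst].
      exact: twist_continuous.
    by apply: (continuous_big (@add_continuous C)) => q _; exact: ctw.
  exact: mulrl_continuous.
congr (_ * _).
rewrite -(quotient_by_shift (f := fun u => twist g (sec' k) (t + lattice u)) (- p) quo).
  by apply: eq_bigr => q _; rewrite /lattice map_mxD map_mxN addrA addrAC.
by move=> u w; rewrite /lattice map_mxD addrA twist_lattice.
Qed.

(* Fourier inversion on Z^n / M Z^n: averaging g(x + M^-1 q) against the character
   q |-> e(k . M^-1 q) isolates the k-th term of [recompose]. *)
Definition component g k : CT := MkCT (component_torus g k).

Lemma componentE g k y :
  component g k y = N%:R^-1 * \sum_q twist g (sec' k) (y + lattice (sec q)) :> C.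
Proof. by []. Qed.

Lemma CT_eq (g1 g2 : CT) : (forall x, g1 x = g2 x) -> g1 = g2.
Proof. by move=> g12; apply/val_inj/funext. Qed.

Lemma N_neq0 : N%:R != 0 :> C.
Proof. by rewrite pnatr_eq0 -lt0n. Qed.

(** The l-th summand acquires the factor chi (l - k) at M^-1 q, and its sum over q vanishes unless l
    - k lies in M^T Z^n, that is unless l = k. *)
Lemma recomposeK h k : component (recompose h) k = h k.
Proof.
apply: CT_eq => y; rewrite componentE.
have Mu := intmx_unit R M0.
have tw q : twist (recompose h) (sec' k) (y + lattice (sec q)) =
    \sum_l h l y * chi (sec' l - sec' k) (invmx MR *m y) *
      chi (sec' l - sec' k) (invmx MR *m lattice (sec q)).
  rewrite /twist CTval_sum mulr_suml; apply: eq_bigr => l _.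
  rewrite CTvalM pullbackE chiCTE mulKVmx // torus_funD -mulrA -mulrA.
  by congr (_ * _); rewrite -chiDr -mulmxDr chiDl chiNl.
under eq_bigr do rewrite tw.
rewrite exchange_big /= (bigD1 k) //= [X in _ + X]big1 => [|l lk].
  under eq_bigr do rewrite subrr !chi0l !mulr1.
  by rewrite sumr_const card_ord addr0 -[h k y *+ N]mulr_natl mulKf ?N_neq0.
rewrite -mulr_sumr (sum_chi _ _ quo) //; case: asboolP => [[w kw]|]; last first.
  by rewrite mulr0.
suff e : l = k by rewrite e eqxx in lk.
case: quo' => sec'K red'P; rewrite -(sec'K l) -(sec'K k); apply/red'P.
by exists w; rewrite -kw addrC subrK.
Qed.

(** Summing over k first, the characters at M^-1 q cancel unless q is the class of 0, where only
    g(x) remains. *)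
Lemma componentK g : recompose (component g) = g.
Proof.
apply: CT_eq => x; rewrite CTval_sum.
have Mu := intmx_unit R M0.
have tm k : (pullback (component g k) * chiCT R (sec' k)) x =
    N%:R^-1 * \sum_q g (x + invmx MR *m lattice (sec q)) *
      (chi (sec' k) (invmx MR *m lattice (sec q)))^*.
  rewrite CTvalM pullbackE componentE chiCTE -mulrA mulr_suml; congr (_ * _).
  apply: eq_bigr => q _; rewrite /twist mulmxDr mulKmx // chiDr rmorphM /=.
  rewrite -mulrA; congr (_ * _).
  by rewrite mulrAC chi_conjK mul1r.
under eq_bigr do rewrite tm.
(* The representative of the class of 0 may be nonzero, but it lies in M Z^n, so M^-1 sends it to a
   period of g. *)
have [w secw] : exists w, sec (red 0) = M *m w.
  have [secK redP] := quo; have /redP[w secw] := secK (red 0).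
  by exists w; rewrite secw add0r.
have sum_k q : \sum_k chi (sec' k) (invmx MR *m lattice (sec q)) =
    if q == red 0 then N%:R else 0.
  rewrite -(sum_chi_dual R q _ M0 quo quo'); apply: eq_bigr => k _.
  rewrite secw /lattice map_mxB map_mxM mulmxBr mulKmx // chiBr chi_lattice.
  by rewrite rmorph1 mulr1.
rewrite -mulr_sumr exchange_big /= (bigD1 (red 0)) //= [X in _ + X]big1 => [|q q0].
  rewrite -mulr_sumr -rmorph_sum sum_k eqxx rmorph_nat addr0 mulrCA mulVf ?N_neq0 //.
  by rewrite mulr1 secw /lattice map_mxM mulKmx // torus_funD.
by rewrite -mulr_sumr -rmorph_sum sum_k (negPf q0) rmorph0 mulr0.
Qed.

Lemma recompose_linear a h h' :
  recompose (fun k => a * h k + h' k) = pullback a * recompose h + recompose h'.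
Proof.
rewrite /recompose mulr_sumr -big_split; apply: eq_bigr => k _ /=.
by rewrite mulrA -mulrDl; congr (_ * _); apply: CT_eq.
Qed.

Lemma dilD (c : C) (xi eta : funRn R n) :
  dil c M (xi + eta) = dil c M xi + dil c M eta.
Proof. by apply/funext => x; exact: mulrDr. Qed.

Lemma dilZ (c : C) a (xi : funRn R n) :
  dil c M (pullback a *: xi) = a *: dil c M xi.
Proof.
apply/funext => x; have aE : pullback a (invmx MR *m x) = a x.
  by rewrite pullbackE mulKVmx ?intmx_unit.
exact: etrans (congr1 (fun z => c * (z * xi (invmx MR *m x))) aE) (mulrCA _ _ _).
Qed.

(** A vector of length r N is reshaped into an r x N matrix, and [recompose] turns its s-th row into
    the s-th coordinate of an element of [W]. This is semilinear along [pullback], which [dilZ]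
    undoes. *)
Lemma free_of_rank_dil (c : C) (W : set (funRn R n)) (r : nat) : c != 0 ->
  free_of_rank W r -> free_of_rank (dil c M @` W) (r * N).
Proof.
move=> c0 [f [fW finj fsurj]].
have Mu := intmx_unit R M0.
pose F (v : 'rV[CT]_(r * N)) : funRn R n :=
  dil c M (f (\row_s recompose (fun k => vec_mx v s k))).
have Flin : linear F.
  move=> a v w; rewrite /F.
  have -> : (\row_s recompose (fun k => vec_mx (a *: v + w) s k)) =
      pullback a *: (\row_s recompose (fun k => vec_mx v s k)) +
      \row_s recompose (fun k => vec_mx w s k).
    apply/rowP => s; rewrite !mxE -recompose_linear; congr recompose.
    by apply/funext => k; rewrite linearP !mxE.
  by rewrite linearP dilD dilZ.
pose FL : {linear 'rV[CT]_(r * N) -> funRn R n} :=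
  HB.pack F (GRing.isLinear.Build _ _ _ _ F Flin).
exists FL; split.
- by move=> v _; apply: imageP; exact: fW.
- move=> v w _ _ /= Fvw.
  have fvw : f (\row_s recompose (fun k => vec_mx v s k)) =
      f (\row_s recompose (fun k => vec_mx w s k)).
    (* Evaluation at M x inverts the dilation up to the nonzero factor c. *)
    apply/funext => x; have := congr1 (fun g : funRn R n => g (MR *m x)) Fvw.
    by rewrite /= /F /dil mulKmx // => /(mulfI c0).
  have /rowP vw := finj _ _ (mem_set Logic.I) (mem_set Logic.I) fvw.
  rewrite -[v]vec_mxK -[w]vec_mxK; congr mxvec; apply/matrixP => s k.
  have := vw s; rewrite [LHS]mxE [RHS]mxE => /(congr1 (fun g => component g k)).
  by rewrite !recomposeK.
- move=> _ [xi /fsurj[u _ <-] <-].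
  exists (mxvec (\matrix_(s, k) component (u 0 s) k)) => //=.
  rewrite /F mxvecK; congr (dil c M (f _)); apply/rowP => s; rewrite mxE.
  rewrite -[RHS]componentK; congr recompose; apply/funext => k.
  by rewrite mxE.
Qed.

End DilatedFree.

(** * Powers of the dilation and the ranks of the W_i *)

Lemma det_neq0_dilation (R : realType) (n : nat) (A : 'M[int]_n) :
  dilation_matrix R A -> \det A != 0.
Proof.
move=> hA; apply/negP => /eqP A0.
have : eigenvalue (map_mx intr A : 'M[R[i]]_n) 0.
  rewrite eigenvalue_root_char /root horner_coef0 char_poly_det det_map_mx A0.
  by rewrite rmorph0 mulr0.
by move=> /hA; rewrite normr0 ltr10.
Qed.

Lemma iter_Dil (R : realType) (n : nat) (A : 'M[int]_n) (i : nat) (xi : funRn R n) :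
  \det A != 0 ->
  iter i (Dil A) xi =
  dil ((sqrtdet R A)^-1%:C%C ^+ i) (iter i (mulmx A^T) 1%:M) xi.
Proof.
move=> A0; have AT0 : \det A^T != 0 by rewrite det_tr.
elim: i => [|i IH]; first by apply/funext => x;
  rewrite /dil expr0 mul1r map_mx1 invmx1 mul1mx.
have detM : \det (iter i (mulmx A^T) 1%:M) != 0.
  elim: (i) => [|j IHj] /=; first by rewrite det1.
  by rewrite det_mulmx mulf_neq0.
apply/funext => x; rewrite iterS IH /dil /Dil exprS -mulrA; congr (_ * (_ * xi _)).
rewrite /realAt iterS map_trmx map_mxM.
set B := map_mx intr A^T; set P := map_mx intr _.
have Bu : B \in unitmx by exact: intmx_unit.
have Pu : P \in unitmx by exact: intmx_unit.
(* Both arguments of xi equal P^-1 B^-1 x; for (B P)^-1 x, write x as B P P^-1 B^-1 x. *)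
rewrite -[in LHS](mulKVmx Bu x) mulKmx // -[in LHS](mulKVmx Pu (invmx B *m x)).
by rewrite mulKmx // -{2}(mulKVmx Bu x) -{2}(mulKVmx Pu (invmx B *m x)) mulmxA
  mulKmx ?unitmx_mul ?Bu.
Qed.

Theorem mainTheorem7 (R : realType) (n : nat) (hn : (2 <= n)%N)
    (A : 'M[int]_n) (hA : dilation_matrix R A)
    (d : nat) (hd : `|\det A|%N = d)
    (V : int -> set (funRn R n)) (hV : projective_MRA A V) (r : nat)
    (hW0 : free_of_rank (ominus (V 1) (V 0)) r) (i : nat) :
  free_of_rank (ominus (V i.+1) (V i)) (r * d ^ i)%N.
Proof.
have A0 := det_neq0_dilation hA.
set c := (sqrtdet R A)^-1%:C%C ^+ i.
set M := iter i (mulmx A^T) 1%:M.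
have detM : \det M = \det A ^+ i.
  rewrite /M; elim: (i) => [|j IHj] /=; first by rewrite det1.
  by rewrite det_mulmx det_tr IHj exprS.
have M0 : \det M != 0 by rewrite detM expf_neq0.
have c0 : c != 0.
  rewrite expf_neq0 // fmorph_eq0.
  by rewrite invr_eq0 sqrtdet_neq0.
have iterE : iter i (Dil A) = dil c M.
  by apply/funext => xi; exact: iter_Dil.
have Vi : V i = dil c M @` V 0 by rewrite (PMRA_dil hV) -iterE.
(* Splitting D^(i+1) as D^i after D presents V_(i+1) as the image of V_1 under the same map that
   sends V_0 to V_i. *)
have ViS : V i.+1 = dil c M @` V 1.
  rewrite (PMRA_dil hV i.+1) (PMRA_dil hV 1) -iterE image_comp.
  by congr image; apply/funext => xi; exact: iterSr.
have V0scale (g : CT R n) eta : V 0 eta -> V 0 (g *: eta).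
  move=> V0eta; have [V00 V0lin] := PMRA_submod hV.
  rewrite -[g *: eta]addr0; apply/set_mem.
  by apply: V0lin => //; exact/mem_set.
have VXi j : V j `<=` @Xi R n by exact: (@PMRA_Xi _ _ _ _ hV j).
rewrite Vi ViS (ominus_dil M0 c0 (VXi 1) (VXi 0) V0scale).
have [sec [red quo]] := exists_quotient_by M0.
have [sec' [red' quo']] : exists sec red, @quotient_by n M^T (absz (\det M)) sec red.
  by have := @exists_quotient_by n M^T; rewrite det_tr; exact.
have -> : (d ^ i = absz (\det M))%N by rewrite detM abszX hd.
by apply: (free_of_rank_dil M0 quo quo' _ c0 hW0); rewrite absz_gt0.
Qed.
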